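(* For integers $m,n\ge 1$ with $\gcd(m,n)=1$ and integer $p\ge 2$, $$\sum_{k=1}^\infty\frac{H_k}{(mk+n)^p}=\frac{(-1)^{p-1}}{2m^p(p-1)!}\left(\psi^{(p)}\left(\frac nm\right)-2\gamma\,\psi^{(p-1)}\left(\frac nm\right)-\sum_{k=0}^{p-1}\binom{p-1}{k}\psi^{(k)}\left(\frac nm\right)\psi^{(p-1-k)}\left(\frac nm\right)\right).$$
   Context: $H_k = 1+1/2+\cdots+1/k$ is the $k$th harmonic number. $\gamma$ is Euler's constant. $\psi(z)=\Gamma'(z)/\Gamma(z)$ is the digamma function, and $\psi^{(n)}$ denotes its $n$-th derivative, with $\psi^{(0)}=\psi$. *)

(* Defs.v *)
From Stdlib Require Import Reals.
From Coquelicot Require Import Coquelicot.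
Open Scope R_scope.

Definition harmonic (k : nat) : R := sum_n_m (fun i : nat => / INR i) 1 k.

Definition Euler_gamma : R :=
  real (Lim_seq (fun n : nat => harmonic n - ln (INR n))).

(** Euler's integral over ]0, +oo[.  It converges exactly for [x > 0]; the value
    at [x <= 0] is unspecified, so [digamma] and [polygamma] below are only
    meaningful at positive arguments. *)
Definition Gamma (x : R) : R :=
  RInt_gen (fun t : R => Rpower t (x - 1) * exp (- t))
    (at_right 0) (Rbar_locally p_infty).

Definition digamma (x : R) : R := Derive Gamma x / Gamma x.

Definition polygamma (j : nat) (x : R) : R := Derive_n digamma j x.

(* Main.v *)
(** Put [a = n/m], [q = p - 1] and [x_j = 1/(j+a)].  For [i <> j],
    [x_i - x_j = (j-i) x_i x_j], so the geometric sum gives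
    [sum_(k<=q) x_i^(k+1) x_j^(q+1-k) = (x_i^(q+1) - x_j^(q+1)) / (j-i)].  Summing
    over [i, j <= N], with [G_s = sum_(j<=N) x_j^s],
    [sum_(k<=q) G_(k+1) G_(q+1-k)
     = (q+1) G_(q+2) + 2 sum_(j<=N) (H_(N-j) - H_j) x_j^(q+1)].
    Subtracting [H_(N+1)] from [G_1] turns [H_(N-j)] into [H_(N-j) - H_(N+1)],
    whose contribution vanishes as [N] grows, and all other terms converge to
    values of Hurwitz-type series at [a].

    These series are the polygamma values.  By Young's inequality [ln Gamma] is
    convex; with [Gamma (x+1) = x Gamma x] this traps the slopes of [ln Gamma]
    near [x+n] between logarithms, so that [ln Gamma] has derivative
    [lim (ln n - sum_(j<n) 1/(x+j))], without differentiating under the integral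
    sign.  Higher derivatives are taken term by term. *)
Require Import Defs.
From Stdlib Require Import Arith Factorial Reals Lra Lia.
From Coquelicot Require Import Coquelicot.
Open Scope R_scope.

(** * The finite convolution identity *)

Lemma harmonic_0 : harmonic 0 = 0.
Proof. unfold harmonic. now rewrite sum_n_m_zero; [ | lia ]. Qed.

Lemma harmonic_S (n : nat) : harmonic (S n) = harmonic n + / INR (S n).
Proof. unfold harmonic. rewrite sum_n_Sm by lia. reflexivity. Qed.

Lemma sum_f_R0_rev (f : nat -> R) (n : nat) :
  sum_f_R0 (fun k => f (n - k)%nat) n = sum_f_R0 f n.
Proof.
  induction n as [|n IH]; [reflexivity|].
  rewrite decomp_sum by lia. rewrite tech5, <- IH, Rplus_comm. simpl pred.
  f_equal.
Qed.

Lemma sum_f_R0_scal_l (f : nat -> R) (c : R) (n : nat) :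
  sum_f_R0 (fun k => c * f k) n = c * sum_f_R0 f n.
Proof. rewrite scal_sum. apply sum_eq. intros; ring. Qed.

Lemma harmonic_rev (n : nat) :
  sum_f_R0 (fun j => / INR (S n - j)) n = harmonic (S n).
Proof.
  rewrite <- (sum_f_R0_rev (fun j => / INR (S n - j))).
  rewrite (sum_eq _ (fun k => / INR (S k))).
  2:{ intros i Hi. f_equal. f_equal. lia. }
  induction n as [|n IH].
  - rewrite harmonic_S, harmonic_0. simpl. ring.
  - rewrite tech5, IH, (harmonic_S (S n)). reflexivity.
Qed.

Lemma harmonic_sum (n : nat) : sum_f_R0 (fun j => / INR (S j)) n = harmonic (S n).
Proof.
  rewrite <- harmonic_rev, <- (sum_f_R0_rev (fun j => / INR (S j))).
  apply sum_eq. intros j Hj. do 2 f_equal. lia.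
Qed.

Lemma pow_sub_factor (x y : R) (q : nat) :
  (x - y) * sum_f_R0 (fun k => x ^ k * y ^ (q - k)) q = x ^ S q - y ^ S q.
Proof.
  induction q as [|q IH]; [simpl; ring|].
  rewrite tech5, Nat.sub_diag.
  rewrite (sum_eq _ (fun k => y * (x ^ k * y ^ (q - k)))).
  2:{ intros i Hi. rewrite Nat.sub_succ_l by exact Hi. simpl. ring. }
  rewrite sum_f_R0_scal_l, Rmult_plus_distr_l.
  replace ((x - y) * (y * sum_f_R0 (fun k => x ^ k * y ^ (q - k)) q))
    with (y * ((x - y) * sum_f_R0 (fun k => x ^ k * y ^ (q - k)) q)) by ring.
  rewrite IH. simpl. ring.
Qed.

(** The truncated Hurwitz zeta function at [s], written [G_s] in the overview. *)
Definition inv_pow_sum (a : R) (s n : nat) : R :=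
  sum_f_R0 (fun j => (/ (INR j + a)) ^ s) n.

Lemma INR_plus_pos (a : R) (j : nat) : 0 < a -> 0 < INR j + a.
Proof. intros Ha. pose proof (pos_INR j). lra. Qed.

(* With [x = / (j + a)] and [y = / (n + 1 + a)] one has
   [x - y = (n + 1 - j) * x * y]. *)
Lemma cross_terms (a : R) (n q j : nat) : 0 < a -> (j <= n)%nat ->
  sum_f_R0 (fun k => (/ (INR j + a)) ^ S k * (/ (INR (S n) + a)) ^ S (q - k)) q
  = / INR (S n - j) * ((/ (INR j + a)) ^ S q - (/ (INR (S n) + a)) ^ S q).
Proof.
  intros Ha Hj.
  pose proof (INR_plus_pos a j Ha). pose proof (INR_plus_pos a (S n) Ha).
  set (x := / (INR j + a)). set (y := / (INR (S n) + a)).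
  assert (Hd : 0 < INR (S n - j)) by (apply lt_0_INR; lia).
  assert (Hxy : x - y = INR (S n - j) * (x * y)).
  { unfold x, y. rewrite minus_INR by lia. field. lra. }
  rewrite (sum_eq _ (fun k => (x * y) * (x ^ k * y ^ (q - k)))).
  2:{ intros; simpl; ring. }
  rewrite sum_f_R0_scal_l, <- pow_sub_factor, Hxy. field. lra.
Qed.

Lemma sum_f_R0_exchange (f : nat -> nat -> R) (n q : nat) :
  sum_f_R0 (fun k => sum_f_R0 (fun j => f j k) n) q
  = sum_f_R0 (fun j => sum_f_R0 (fun k => f j k) q) n.
Proof.
  induction n as [|n IH]; [reflexivity|].
  rewrite tech5, <- IH, <- sum_plus. reflexivity.
Qed.

(** Induction on [n]. The new point [y] creates two equal sums of cross terms. By [cross_terms] each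
    supplies the increments [/ INR (S n - j)] that turn [harmonic (n - j)] into
    [harmonic (S n - j)], and leaves [- harmonic (S n) * y ^ S q], half of the new term at
    [j = S n]. *)
Lemma inv_pow_sum_convolution (a : R) (q n : nat) : 0 < a ->
  sum_f_R0 (fun k => inv_pow_sum a (S k) n * inv_pow_sum a (S (q - k)) n) q
  = INR (S q) * inv_pow_sum a (S (S q)) n
    + 2 * sum_f_R0 (fun j => (harmonic (n - j) - harmonic j)
                             * (/ (INR j + a)) ^ S q) n.
Proof.
  intros Ha. induction n as [|n IH].
  - assert (Hs : forall s, inv_pow_sum a s 0 = (/ (INR 0 + a)) ^ s)
      by reflexivity.
    rewrite (sum_eq _ (fun _ => (/ (INR 0 + a)) ^ S (S q))).
    2:{ intros i Hi. rewrite !Hs, <- pow_add. f_equal. lia. }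
    rewrite sum_cte, Hs. unfold sum_f_R0. rewrite Nat.sub_diag. ring.
  - set (y := / (INR (S n) + a)).
    assert (Hs : forall s, inv_pow_sum a s (S n) = inv_pow_sum a s n + y ^ s)
      by reflexivity.
    assert (Hc : sum_f_R0 (fun k => inv_pow_sum a (S k) n * y ^ S (q - k)) q
      = sum_f_R0 (fun j => / INR (S n - j) * (/ (INR j + a)) ^ S q) n
        - harmonic (S n) * y ^ S q).
    { rewrite <- harmonic_rev, (Rmult_comm _ (y ^ S q)), scal_sum, <- minus_sum.
      rewrite (sum_eq _ (fun k => sum_f_R0
        (fun j => (/ (INR j + a)) ^ S k * y ^ S (q - k)) n)).
      2:{ intros i Hi. unfold inv_pow_sum. rewrite Rmult_comm, scal_sum.
          reflexivity. }
      rewrite sum_f_R0_exchange. apply sum_eq. intros j Hj.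
      unfold y. rewrite cross_terms by assumption. ring. }
    (* The second cross term is written with [q - (q - k)] in place of [k], so that reversing the
       summation identifies it with the first. *)
    rewrite (sum_eq _ (fun k =>
      inv_pow_sum a (S k) n * inv_pow_sum a (S (q - k)) n
      + inv_pow_sum a (S k) n * y ^ S (q - k)
      + (inv_pow_sum a (S (q - k)) n * y ^ S (q - (q - k)) + y ^ S (S q)))).
    2:{ intros k Hk. rewrite !Hs. replace (q - (q - k))%nat with k by lia.
        replace (S (S q)) with (S k + S (q - k))%nat by lia.
        rewrite pow_add. ring. }
    rewrite !sum_plus, IH, sum_cte, Hs.
    rewrite (sum_f_R0_rev (fun k => inv_pow_sum a (S k) n * y ^ S (q - k))), Hc.
    rewrite (tech5 (fun j => (harmonic (S n - j) - harmonic j) * _)).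
    rewrite Nat.sub_diag, harmonic_0. fold y.
    rewrite (sum_eq (fun j => (harmonic (S n - j) - harmonic j) * _)
      (fun j => (harmonic (n - j) - harmonic j) * (/ (INR j + a)) ^ S q
                + / INR (S n - j) * (/ (INR j + a)) ^ S q)).
    2:{ intros j Hj. rewrite Nat.sub_succ_l by exact Hj.
        rewrite harmonic_S. ring. }
    rewrite sum_plus. ring.
Qed.

(* Both the divergence of the first power sum and Euler's constant enter as a
   shift of the entry of index [0]. *)
Lemma convolution_shift_0 (w u v : nat -> R) (c : R) (q : nat) :
  (1 <= q)%nat -> w 0%nat = 1 -> w q = 1 ->
  v 0%nat = u 0%nat + c -> (forall k, (1 <= k)%nat -> v k = u k) ->
  sum_f_R0 (fun k => w k * v k * v (q - k)%nat) q
  = sum_f_R0 (fun k => w k * u k * u (q - k)%nat) q + 2 * c * u q.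
Proof.
  intros Hq Hw0 Hwq Hv0 Hv. destruct q as [|q]; [lia|].
  rewrite !tech5, Nat.sub_diag, !Hwq, !Hv0, !(Hv (S q)) by lia.
  destruct q as [|q].
  - simpl. rewrite Hw0, Hv0, (Hv 1%nat) by lia. ring.
  - rewrite !(decomp_sum _ (S q)) by lia. simpl pred.
    rewrite !Nat.sub_0_r, Hw0, Hv0, (Hv (S (S q))) by lia.
    rewrite (sum_eq (fun i => w (S i) * v (S i) * v (S (S q) - S i)%nat)
      (fun i => w (S i) * u (S i) * u (S (S q) - S i)%nat)).
    2:{ intros i Hi. rewrite !Hv by lia. reflexivity. }
    ring.
Qed.

(** * Growth of the harmonic numbers and the vanishing error term *)

Lemma harmonic_diff_le (k j : nat) :
  0 <= harmonic (k + j) - harmonic k <= INR j * / INR (S k).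
Proof.
  induction j as [|j IH].
  - rewrite Nat.add_0_r. simpl. lra.
  - rewrite Nat.add_succ_r, harmonic_S, (S_INR j).
    assert (H0 : 0 < INR (S k)) by (apply lt_0_INR; lia).
    assert (H : / INR (S (k + j)) <= / INR (S k)).
    { apply Rinv_le_contravar; [exact H0|]. apply le_INR. lia. }
    assert (0 < / INR (S (k + j))) by (apply Rinv_0_lt_compat, lt_0_INR; lia).
    lra.
Qed.

Lemma ln_le_sub1 (x : R) : 0 < x -> ln x <= x - 1.
Proof.
  intros Hx. pose proof (exp_ineq1_le (ln x)) as H.
  rewrite exp_ln in H by exact Hx. lra.
Qed.

Definition gamma_seq (n : nat) : R := harmonic n - ln (INR n).

Lemma ln_succ_bounds (x : R) : 0 < x -> / (x + 1) <= ln (x + 1) - ln x <= / x.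
Proof.
  intros Hx. split.
  - pose proof (ln_le_sub1 (x / (x + 1)) ltac:(apply Rdiv_lt_0_compat; lra)) as H.
    rewrite ln_div in H by lra.
    replace (x / (x + 1) - 1) with (- / (x + 1)) in H by (field; lra). lra.
  - pose proof (ln_le_sub1 ((x + 1) / x) ltac:(apply Rdiv_lt_0_compat; lra)) as H.
    rewrite ln_div in H by lra.
    replace ((x + 1) / x - 1) with (/ x) in H by (field; lra). lra.
Qed.

(** From index 1 on the sequence decreases and is nonnegative; the shift by one avoids [ln 0]. *)
Lemma gamma_seq_cv : is_lim_seq gamma_seq Euler_gamma.
Proof.
  apply Lim_seq_correct'.
  destruct (ex_finite_lim_seq_decr (fun n => gamma_seq (S n)) 0) as [l Hl].
  - intros n. unfold gamma_seq. rewrite (harmonic_S (S n)), (S_INR (S n)).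
    pose proof (ln_succ_bounds (INR (S n)) ltac:(apply lt_0_INR; lia)). lra.
  - intros n. unfold gamma_seq.
    (* The bound with the next logarithm passes from [n] to [n + 1], which nonnegativity alone would
       not. *)
    cut (ln (INR (S n) + 1) <= harmonic (S n)).
    { pose proof (ln_succ_bounds (INR (S n)) ltac:(apply lt_0_INR; lia)) as H.
      assert (0 < / (INR (S n) + 1)).
      { apply Rinv_0_lt_compat. pose proof (pos_INR (S n)). lra. }
      lra. }
    induction n as [|n IH]; rewrite harmonic_S.
    + rewrite harmonic_0. simpl. pose proof (ln_le_sub1 (1 + 1) ltac:(lra)). lra.
    + rewrite <- S_INR in IH.
      pose proof (ln_succ_bounds (INR (S (S n))) ltac:(apply lt_0_INR; lia)). lra.
  - exists l. now apply is_lim_seq_incr_1.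
Qed.

Lemma harmonic_over_n : is_lim_seq (fun n => harmonic n / INR n) 0.
Proof.
  assert (Hi : is_lim_seq (fun n => / INR n) 0).
  { apply (is_lim_seq_inv INR p_infty); [apply is_lim_seq_INR|discriminate]. }
  apply is_lim_seq_ext with
    (fun n => gamma_seq n * / INR n + ln (INR n) / INR n).
  { intros n. unfold gamma_seq, Rdiv. ring. }
  replace 0 with (Euler_gamma * 0 + 0) by ring.
  apply is_lim_seq_plus'.
  - apply is_lim_seq_mult'; [apply gamma_seq_cv|exact Hi].
  - apply (is_lim_comp_seq (fun x => ln x / x) INR p_infty 0).
    + apply is_lim_div_ln_p.
    + exists 0%nat. discriminate.
    + apply is_lim_seq_INR.
Qed.

Lemma inv_shift_le (a : R) (j : nat) : 0 < a ->
  (INR j + 1) * / (INR j + a) <= 1 + / a.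
Proof.
  intros Ha. pose proof (pos_INR j). pose proof (Rinv_0_lt_compat a Ha).
  apply Rmult_le_reg_r with (INR j + a); [lra|].
  rewrite Rmult_assoc, Rinv_l by lra.
  replace ((1 + / a) * (INR j + a)) with (INR j + a + / a * INR j + 1)
    by (field; lra).
  nra.
Qed.

(** With [c = 1 + / a], two of the factors are bounded by [c * / INR (S j)] and the other [q] by
    [c]. This gives a summable majorant free of the shift. *)
Lemma inv_pow_le (a : R) (q j : nat) : 0 < a ->
  (/ (INR j + a)) ^ S (S q) <= (1 + / a) ^ (q + 2) * (/ INR (S j)) ^ 2.
Proof.
  intros Ha. set (c := 1 + / a). pose proof (inv_shift_le a j Ha) as Hs. fold c in Hs.
  assert (Hx : 0 < / (INR j + a)) by apply Rinv_0_lt_compat, INR_plus_pos, Ha.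
  assert (Hj : 1 <= INR (S j)) by (apply (le_INR 1); lia).
  assert (Hy : 0 < / INR (S j)) by (apply Rinv_0_lt_compat; lra).
  rewrite <- S_INR in Hs.
  assert (Hxc : / (INR j + a) <= c) by nra.
  assert (Hxcy : / (INR j + a) <= c * / INR (S j)).
  { apply Rmult_le_reg_l with (INR (S j)); [lra|].
    replace (INR (S j) * (c * / INR (S j))) with c by (field; lra). exact Hs. }
  replace (S (S q)) with (q + 2)%nat by lia. rewrite !pow_add, Rmult_assoc.
  rewrite <- Rpow_mult_distr.
  apply Rmult_le_compat; try (apply pow_le; lra); apply pow_incr; lra.
Qed.

(** The harmonic difference is at most [(j + 1) / (n + 1 - j)] and the power at most a constant
    times [1 / (j + 1)^2]. Since [(j + 1) + (n + 1 - j) = n + 2], partial fractions turn the product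
    [1 / ((j + 1) (n + 1 - j))] into two harmonic sums divided by [n + 2], so the total is of order
    [harmonic (S n) / INR (S n)]. *)
Lemma harmonic_tail_error (a : R) (q : nat) : 0 < a -> (1 <= q)%nat ->
  is_lim_seq (fun n => sum_f_R0 (fun j =>
    (harmonic (S n) - harmonic (n - j)) * (/ (INR j + a)) ^ S q) n) 0.
Proof.
  intros Ha Hq. set (c := 1 + / a).
  assert (Hc : 1 <= c) by (pose proof (Rinv_0_lt_compat a Ha); unfold c; lra).
  assert (Hx : forall j, 0 < / (INR j + a)).
  { intros j. apply Rinv_0_lt_compat, INR_plus_pos, Ha. }
  assert (Hn : forall n, 0 < INR (S n)) by (intros; apply lt_0_INR; lia).
  apply (is_lim_seq_le_le (fun _ => 0) _
    (fun n => 2 * (c ^ (q + 1)) * (harmonic (S n) / INR (S n)))).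
  2: apply is_lim_seq_const.
  2:{ replace 0 with (2 * c ^ (q + 1) * 0) by ring.
      apply is_lim_seq_mult'; [apply is_lim_seq_const|].
      apply -> (is_lim_seq_incr_1 (fun n => harmonic n / INR n)).
      apply harmonic_over_n. }
  intros n. split.
  - apply cond_pos_sum. intros j. apply Rmult_le_pos.
    + replace (S n) with ((n - j) + (S n - (n - j)))%nat by lia.
      apply harmonic_diff_le.
    + apply pow_le, Rlt_le, Hx.
  - apply Rle_trans with (sum_f_R0 (fun j => c ^ (q + 1) * / INR (S n) *
      (/ INR (S j) + / INR (S n - j))) n).
    + apply sum_Rle. intros j Hj.
      assert (Hd : 0 < INR (S n - j)) by (apply lt_0_INR; lia).
      assert (H1 : harmonic (S n) - harmonic (n - j) <= INR (S j) * / INR (S n - j)).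
      { replace (S n) with ((n - j) + S j)%nat at 1 by lia.
        replace (S n - j)%nat with (S (n - j)) by lia. apply harmonic_diff_le. }
      assert (H2 : (/ (INR j + a)) ^ S q <= c ^ (q + 1) * (/ INR (S j)) ^ 2).
      { replace (S q) with (S (S (q - 1))) by lia.
        replace (q + 1)%nat with (q - 1 + 2)%nat by lia. now apply inv_pow_le. }
      apply Rle_trans with ((INR (S j) * / INR (S n - j)) *
        (c ^ (q + 1) * (/ INR (S j)) ^ 2)).
      * apply Rmult_le_compat; [|apply pow_le, Rlt_le, Hx|exact H1|exact H2].
        replace (S n) with ((n - j) + (S n - (n - j)))%nat by lia.
        apply harmonic_diff_le.
      * apply Rle_trans with (c ^ (q + 1) * (/ INR (S n - j) * / INR (S j))).
        -- right. field. split; apply Rgt_not_eq; [apply Hn|exact Hd].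
        -- rewrite Rmult_assoc. apply Rmult_le_compat_l; [apply pow_le; lra|].
           apply Rle_trans with (/ (INR (S n) + 1) * (/ INR (S j) + / INR (S n - j))).
           ++ right. rewrite minus_INR, !S_INR by lia.
              assert (INR j <= INR n) by (apply le_INR; exact Hj).
              pose proof (pos_INR j). field. lra.
           ++ apply Rmult_le_compat_r.
              ** pose proof (Rinv_0_lt_compat _ (Hn j)).
                 pose proof (Rinv_0_lt_compat _ Hd). lra.
              ** apply Rinv_le_contravar; [apply Hn|lra].
    + rewrite sum_f_R0_scal_l, sum_plus, harmonic_rev, harmonic_sum.
      right. unfold Rdiv. ring.
Qed.

(** * The Gamma function *)

Lemma ex_RInt_positive (f : R -> R) (a b : R) :
  (forall t, 0 < t -> continuous f t) -> 0 < a <= b -> ex_RInt f a b.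
Proof.
  intros Hf [Ha Hab]. apply (ex_RInt_continuous f). intros t Ht. apply Hf.
  rewrite Rmin_left in Ht by exact Hab. lra.
Qed.

(** The integrals of a nonnegative function grow with the interval, so the improper integral is
    their supremum: one interval within [eps] of it controls every larger one. *)
Lemma RInt_gen_bounded (f : R -> R) (M : R) :
  (forall t, 0 < t -> continuous f t) -> (forall t, 0 < t -> 0 <= f t) ->
  (forall a b, 0 < a <= b -> RInt f a b <= M) ->
  exists l, is_RInt_gen f (at_right 0) (Rbar_locally p_infty) l
            /\ forall a b, 0 < a <= b -> RInt f a b <= l.
Proof.
  intros Hc Hp HM.
  destruct (completeness (fun v => exists a b, 0 < a <= b /\ v = RInt f a b))
    as [l [Hub Hlub]].
  { exists M. intros v (a & b & Hab & ->). now apply HM. }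
  { exists (RInt f 1 1), 1, 1. split; [lra|reflexivity]. }
  assert (Hl : forall a b, 0 < a <= b -> RInt f a b <= l).
  { intros a b Hab. apply Hub. now exists a, b. }
  exists l. split; [|exact Hl].
  intros P [eps Heps].
  assert (Hex : exists a b, 0 < a <= b /\ l - eps < RInt f a b).
  { destruct (Classical_Prop.classic
      (exists a b, 0 < a <= b /\ l - eps < RInt f a b)) as [H|H]; [exact H|].
    exfalso. assert (l <= l - eps); [|pose proof (cond_pos eps); lra].
    apply Hlub. intros v (a & b & Hab & ->).
    apply Rnot_lt_le. intros Hlt. apply H. now exists a, b. }
  destruct Hex as (a0 & b0 & Hab0 & Hlt).
  apply Filter_prod with (fun a => 0 < a < a0) (fun b => b0 < b).
  - assert (H0 : 0 < a0) by lra. exists (mkposreal a0 H0).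
    intros y Hy Hy0. split; [exact Hy0|].
    unfold ball in Hy. simpl in Hy. unfold AbsRing_ball, abs, minus, plus, opp in Hy.
    simpl in Hy. apply Rabs_def2 in Hy. lra.
  - exists b0. auto.
  - intros a b Ha Hb. exists (RInt f a b). simpl. split.
    + apply (RInt_correct f). apply ex_RInt_positive; [exact Hc|lra].
    + apply Heps. unfold ball. simpl.
      unfold AbsRing_ball, abs, minus, plus, opp. simpl.
      assert (RInt f a b <= l) by (apply Hl; lra).
      assert (RInt f a0 b0 <= RInt f a b).
      { rewrite <- (RInt_Chasles f a a0 b), <- (RInt_Chasles f a0 b0 b);
          try (apply ex_RInt_positive; [exact Hc|lra]).
        assert (0 <= RInt f a a0).
        { apply RInt_ge_0; [lra|apply ex_RInt_positive; [exact Hc|lra]|].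
          intros t Ht. apply Hp. lra. }
        assert (0 <= RInt f b0 b).
        { apply RInt_ge_0; [lra|apply ex_RInt_positive; [exact Hc|lra]|].
          intros t Ht. apply Hp. lra. }
        unfold plus. simpl. lra. }
      rewrite Rabs_left1; lra.
Qed.

Definition Gamma_integrand (x t : R) : R := Rpower t (x - 1) * exp (- t).

Lemma Gamma_integrand_pos (x t : R) : 0 < Gamma_integrand x t.
Proof. apply Rmult_lt_0_compat; apply exp_pos. Qed.

Lemma Gamma_integrand_continuous (x t : R) :
  0 < t -> continuous (Gamma_integrand x) t.
Proof.
  intros Ht. apply (ex_derive_continuous (Gamma_integrand x)).
  unfold Gamma_integrand, Rpower. auto_derive. exact Ht.
Qed.

Lemma exp_le (x y : R) : x <= y -> exp x <= exp y.
Proof.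
  intros [H| ->]; [now apply Rlt_le, exp_increasing|apply Rle_refl].
Qed.

Lemma Rpower_le_exp_half (x : R) : 0 < x ->
  exists K, 0 < K /\ forall t, 0 < t -> Rpower t x <= K * exp (t / 2).
Proof.
  (* The inequality [ln u <= u - 1] at [u = t / (2 * x)], multiplied by [x], gives
     [x * ln t <= t / 2 - x + x * ln (2 * x)]. *)
  intros Hx. exists (exp (x * ln (2 * x))). split; [apply exp_pos|].
  intros t Ht. rewrite <- exp_plus. unfold Rpower. apply exp_le.
  assert (H : ln (t / (2 * x)) <= t / (2 * x) - 1).
  { apply ln_le_sub1, Rdiv_lt_0_compat; lra. }
  rewrite ln_div in H by lra.
  apply (Rmult_le_compat_l x) in H; [|lra].
  replace (x * (t / (2 * x) - 1)) with (t / 2 - x) in H by (field; lra).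
  lra.
Qed.

(* The majorant has the bounded antiderivative [- C / (x * (1 + t^x))]. *)
Lemma Gamma_integrand_dominated (x : R) : 0 < x ->
  exists C, 0 < C /\ forall t, 0 < t ->
    Gamma_integrand x t <= C * (Rpower t (x - 1) / (1 + Rpower t x) ^ 2).
Proof.
  intros Hx. destruct (Rpower_le_exp_half x Hx) as (K & HK & HKt).
  (* From [1 + t^x <= (1 + K) * exp (t / 2)]: squaring produces [exp t], which cancels the decaying
     factor of the integrand. *)
  exists ((1 + K) ^ 2). split; [apply pow_lt; lra|].
  intros t Ht. unfold Gamma_integrand.
  pose proof (HKt t Ht) as H. set (r := Rpower t x) in *.
  assert (Hr : 0 < r) by apply exp_pos.
  assert (He : 1 <= exp (t / 2)).
  { rewrite <- exp_0. apply exp_le. lra. }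
  assert (H2 : (1 + r) ^ 2 <= (1 + K) ^ 2 * exp t).
  { replace (exp t) with (exp (t / 2) ^ 2)
      by (simpl; rewrite Rmult_1_r, <- exp_plus; f_equal; field).
    rewrite <- Rpow_mult_distr. apply pow_incr. nra. }
  assert (Hr2 : 0 < (1 + r) ^ 2) by (apply pow_lt; lra).
  unfold Rdiv. rewrite (Rmult_comm ((1 + K) ^ 2)), Rmult_assoc.
  apply Rmult_le_compat_l; [apply Rlt_le, exp_pos|].
  rewrite exp_Ropp. pose proof (exp_pos t) as Het.
  apply Rmult_le_reg_l with (exp t * (1 + r) ^ 2); [nra|].
  field_simplify; lra.
Qed.

Lemma Gamma_integral (x : R) : 0 < x ->
  exists l, is_RInt_gen (Gamma_integrand x) (at_right 0) (Rbar_locally p_infty) l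
            /\ 0 < l.
Proof.
  intros Hx. destruct (Gamma_integrand_dominated x Hx) as (C & HC & HCt).
  destruct (RInt_gen_bounded (Gamma_integrand x) (C / x)) as (l & Hl & Hle).
  - apply Gamma_integrand_continuous.
  - intros; apply Rlt_le, Gamma_integrand_pos.
  - intros a b Hab.
    set (g := fun t => C * (Rpower t (x - 1) / (1 + Rpower t x) ^ 2)).
    set (G := fun t => - (C / x) * / (1 + Rpower t x)).
    assert (Hp : forall t, 0 < 1 + Rpower t x).
    { intros t. pose proof (exp_pos (x * ln t)). unfold Rpower. lra. }
    assert (HG : is_RInt g a b (minus (G b) (G a))).
    { apply (is_RInt_derive (V := R_CompleteNormedModule) G g).
      - intros t Ht. rewrite Rmin_left in Ht by lra. unfold G, g.
        assert (Ht0 : 0 < t) by lra. specialize (Hp t).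
        assert (Hpow : Rpower t (x - 1) = Rpower t x / t).
        { unfold Rminus. rewrite Rpower_plus, Rpower_Ropp, Rpower_1 by exact Ht0.
          reflexivity. }
        rewrite Hpow. unfold Rpower in *. auto_derive.
        + repeat split; lra.
        + field. lra.
      - intros t Ht. rewrite Rmin_left in Ht by lra.
        specialize (Hp t). apply (ex_derive_continuous g). unfold g, Rpower in *.
        auto_derive. repeat split; try lra.
        apply Rgt_not_eq. simpl. nra. }
    apply Rle_trans with (RInt g a b).
    + apply RInt_le; [lra| | |].
      * apply ex_RInt_positive; [apply Gamma_integrand_continuous|lra].
      * eexists; exact HG.
      * intros t Ht. apply HCt. lra.
    + rewrite (is_RInt_unique _ _ _ _ HG). unfold minus, plus, opp, G. simpl.
      assert (0 < / (1 + Rpower b x)) by apply Rinv_0_lt_compat, Hp.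
      assert (/ (1 + Rpower a x) <= 1).
      { rewrite <- Rinv_1. apply Rinv_le_contravar; [lra|].
        pose proof (exp_pos (x * ln a)). unfold Rpower. lra. }
      assert (0 < C / x) by (apply Rdiv_lt_0_compat; lra).
      nra.
  - exists l. split; [exact Hl|].
    (* Any nondegenerate interval serves as a witness of strict positivity. *)
    apply Rlt_le_trans with (RInt (Gamma_integrand x) 1 2); [|apply Hle; lra].
    apply RInt_gt_0; [lra| |].
    + intros; apply Gamma_integrand_pos.
    + intros; apply Gamma_integrand_continuous; lra.
Qed.

Lemma Gamma_correct (x : R) : 0 < x ->
  is_RInt_gen (Gamma_integrand x) (at_right 0) (Rbar_locally p_infty) (Gamma x).
Proof.
  intros Hx. destruct (Gamma_integral x Hx) as (l & Hl & _).
  apply (RInt_gen_correct (V := R_CompleteNormedModule)). now exists l.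
Qed.

Lemma Gamma_pos (x : R) : 0 < x -> 0 < Gamma x.
Proof.
  intros Hx. destruct (Gamma_integral x Hx) as (l & Hl & Hp).
  unfold Gamma. erewrite (is_RInt_gen_unique (V := R_CompleteNormedModule)); eauto.
Qed.

Lemma filter_prod_positive :
  filter_prod (at_right 0) (Rbar_locally p_infty) (fun ab => 0 < fst ab <= snd ab).
Proof.
  apply Filter_prod with (fun a => 0 < a < 1) (fun b => 1 < b).
  - exists (mkposreal 1 Rlt_0_1).
    intros y Hy Hy0. split; [exact Hy0|].
    unfold ball in Hy. simpl in Hy. unfold AbsRing_ball, abs, minus, plus, opp in Hy.
    simpl in Hy. apply Rabs_def2 in Hy. lra.
  - exists 1. auto.
  - simpl. intros; lra.
Qed.

Lemma is_lim_Rpower_0 (x : R) : 0 < x ->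
  filterlim (fun t => Rpower t x * exp (- t)) (at_right 0) (locally 0).
Proof.
  intros Hx. apply filterlim_locally. intros eps.
  (* This radius is [eps^(1/x)]; the exponential factor is at most 1 for positive [t]. *)
  exists (mkposreal _ (exp_pos (ln eps / x))).
  intros t Ht Ht0.
  unfold ball in *. simpl in *. unfold AbsRing_ball, abs, minus, plus, opp in *.
  simpl in *. replace (t + - 0) with t in Ht by ring.
  rewrite Rabs_pos_eq in Ht by lra.
  assert (H0 : 0 < Rpower t x) by apply exp_pos.
  assert (H1 : 0 < exp (- t) <= 1).
  { split; [apply exp_pos|]. rewrite <- exp_0. apply exp_le. lra. }
  replace (Rpower t x * exp (- t) + - 0) with (Rpower t x * exp (- t)) by ring.
  rewrite Rabs_pos_eq by nra.
  apply Rle_lt_trans with (Rpower t x); [nra|].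
  rewrite <- (exp_ln eps) by apply cond_pos.
  unfold Rpower. apply exp_increasing.
  replace (ln eps) with (x * (ln eps / x)) by (field; lra).
  apply Rmult_lt_compat_l; [exact Hx|].
  apply exp_lt_inv. now rewrite exp_ln.
Qed.

Lemma is_lim_Rpower_p_infty (x : R) : 0 < x ->
  filterlim (fun t => Rpower t x * exp (- t)) (Rbar_locally p_infty) (locally 0).
Proof.
  intros Hx. destruct (Rpower_le_exp_half x Hx) as (K & HK & HKt).
  apply filterlim_locally. intros eps.
  (* Beyond this threshold [K * exp (- t / 2) < eps]. *)
  exists (Rmax 0 (- 2 * ln (eps / K))). intros t Ht.
  pose proof (Rmax_l 0 (- 2 * ln (eps / K))) as Hm0.
  pose proof (Rmax_r 0 (- 2 * ln (eps / K))) as Hm1.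
  unfold ball. simpl. unfold AbsRing_ball, abs, minus, plus, opp. simpl.
  assert (H0 : 0 < Rpower t x) by apply exp_pos.
  assert (H1 := exp_pos (- t)).
  replace (Rpower t x * exp (- t) + - 0) with (Rpower t x * exp (- t)) by ring.
  rewrite Rabs_pos_eq by nra.
  apply Rle_lt_trans with (K * exp (- t / 2)).
  - replace (exp (- t / 2)) with (exp (t / 2) * exp (- t))
      by (rewrite <- exp_plus; f_equal; field).
    rewrite <- Rmult_assoc. apply Rmult_le_compat_r; [lra|]. apply HKt. lra.
  - pose proof (cond_pos eps).
    replace (pos eps) with (K * exp (ln (eps / K))).
    + apply Rmult_lt_compat_l; [exact HK|]. apply exp_increasing. lra.
    + rewrite exp_ln by (apply Rdiv_lt_0_compat; lra). field. lra.
Qed.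

(** Integration by parts: the derivative of [t^x * exp (- t)] is integrated once by linearity and
    once through its boundary limits, both zero. *)
Lemma Gamma_succ (x : R) : 0 < x -> Gamma (x + 1) = x * Gamma x.
Proof.
  intros Hx.
  assert (HD : forall t, 0 < t -> is_derive (fun t => Rpower t x * exp (- t)) t
    (x * Gamma_integrand x t - Gamma_integrand (x + 1) t)).
  { intros t Ht. unfold Gamma_integrand.
    replace (x + 1 - 1) with x by ring.
    assert (Hpow : Rpower t (x - 1) = Rpower t x / t).
    { unfold Rminus. rewrite Rpower_plus, Rpower_Ropp, Rpower_1 by exact Ht.
      reflexivity. }
    rewrite Hpow. unfold Rpower. auto_derive; [exact Ht|]. field. lra. }
  assert (H1 : is_RInt_gen (fun t => minus (scal x (Gamma_integrand x t))
      (Gamma_integrand (x + 1) t)) (at_right 0) (Rbar_locally p_infty)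
      (minus (scal x (Gamma x)) (Gamma (x + 1)))).
  { apply (is_RInt_gen_minus (V := R_NormedModule)).
    - apply (is_RInt_gen_scal (V := R_NormedModule)). now apply Gamma_correct.
    - apply Gamma_correct. lra. }
  assert (H2 : is_RInt_gen (fun t => minus (scal x (Gamma_integrand x t))
      (Gamma_integrand (x + 1) t)) (at_right 0) (Rbar_locally p_infty) (0 - 0)).
  { apply is_RInt_gen_ext with (Derive (fun t => Rpower t x * exp (- t))).
    - refine (filter_imp _ _ _ filter_prod_positive). intros [a b] Hab t Ht. simpl in *.
      rewrite Rmin_left in Ht by lra.
      apply is_derive_unique. apply HD. lra.
    - apply is_RInt_gen_Derive.
      + refine (filter_imp _ _ _ filter_prod_positive). intros [a b] Hab t Ht. simpl in *.
        rewrite Rmin_left in Ht by lra. eexists. apply HD. lra.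
      + refine (filter_imp _ _ _ filter_prod_positive). intros [a b] Hab t Ht. simpl in *.
        rewrite Rmin_left in Ht by lra.
        apply (continuous_ext_loc _
          (fun t => x * Gamma_integrand x t - Gamma_integrand (x + 1) t)).
        * assert (Ht0 : 0 < t) by lra.
          refine (filter_imp _ _ _ (open_gt 0 t Ht0)). intros s Hs. symmetry.
          apply is_derive_unique, HD, Hs.
        * apply (continuous_minus (V := R_NormedModule)
            (fun t => x * Gamma_integrand x t)).
          -- apply (continuous_scal_r (V := R_NormedModule) x).
             apply Gamma_integrand_continuous. lra.
          -- apply Gamma_integrand_continuous. lra.
      + now apply is_lim_Rpower_0.
      + now apply is_lim_Rpower_p_infty. }
  apply (is_RInt_gen_unique (V := R_CompleteNormedModule)) in H1, H2.
  rewrite H1 in H2. unfold minus, plus, opp, scal in H2. simpl in H2.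
  unfold mult in H2. simpl in H2. lra.
Qed.

(** * Logarithmic convexity of Gamma and increments of its logarithm *)

Lemma exp_convex (u v r : R) : 0 <= r <= 1 ->
  exp (r * u + (1 - r) * v) <= r * exp u + (1 - r) * exp v.
Proof.
  intros Hr. set (w := r * u + (1 - r) * v).
  (* The tangent at the barycentre [w] lies below the graph; averaging at [u] and [v] cancels its
     slope. *)
  assert (H : forall s, exp w * (1 + (s - w)) <= exp s).
  { intros s. replace s with (w + (s - w)) at 2 by ring. rewrite exp_plus.
    apply Rmult_le_compat_l; [apply Rlt_le, exp_pos|apply exp_ineq1_le]. }
  pose proof (H u) as Hu. pose proof (H v) as Hv.
  apply (Rmult_le_compat_l r) in Hu; [|lra].
  apply (Rmult_le_compat_l (1 - r)) in Hv; [|lra].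
  replace (exp w) with (r * (exp w * (1 + (u - w))) + (1 - r) * (exp w * (1 + (v - w))))
    by (unfold w; ring).
  lra.
Qed.

Definition ln_Gamma (x : R) : R := ln (Gamma x).

(** Hölder's inequality through Young's. Divided by [Gamma x] and [Gamma z], the integrands are
    densities [exp A] and [exp B] of mass 1, and the integrand at [y] is
    [c * exp (r * A + (1 - r) * B)]. Convexity of [exp] and integration give [Gamma y <= c]. *)
Lemma ln_Gamma_convex (x z r : R) : 0 < x -> 0 < z -> 0 <= r <= 1 ->
  ln_Gamma (r * x + (1 - r) * z) <= r * ln_Gamma x + (1 - r) * ln_Gamma z.
Proof.
  intros Hx Hz Hr. set (y := r * x + (1 - r) * z).
  assert (Hy : 0 < y) by (unfold y; nra).
  set (c := exp (r * ln_Gamma x + (1 - r) * ln_Gamma z)).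
  pose proof (Gamma_pos x Hx) as HGx. pose proof (Gamma_pos z Hz) as HGz.
  assert (H : norm (Gamma y) <= plus (scal (c * r / Gamma x) (Gamma x))
                             (scal (c * (1 - r) / Gamma z) (Gamma z))).
  { apply (RInt_gen_norm (V := R_CompleteNormedModule)
      (Fa := at_right 0) (Fb := Rbar_locally p_infty) (Gamma_integrand y)
      (fun t => plus (scal (c * r / Gamma x) (Gamma_integrand x t))
                     (scal (c * (1 - r) / Gamma z) (Gamma_integrand z t)))).
    - refine (filter_imp _ _ _ filter_prod_positive). intros; lra.
    - refine (filter_imp _ _ _ filter_prod_positive). intros [a b] Hab t Ht. simpl in Hab, Ht.
      unfold norm, plus, scal. simpl. unfold mult, abs. simpl.
      rewrite Rabs_pos_eq by apply Rlt_le, Gamma_integrand_pos.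
      set (A := (x - 1) * ln t - t - ln_Gamma x).
      set (B := (z - 1) * ln t - t - ln_Gamma z).
      assert (HA : exp A = Gamma_integrand x t / Gamma x).
      { unfold A, Rminus. rewrite !exp_plus, (exp_Ropp (ln_Gamma x)).
        unfold ln_Gamma. rewrite exp_ln by exact HGx. reflexivity. }
      assert (HB : exp B = Gamma_integrand z t / Gamma z).
      { unfold B, Rminus. rewrite !exp_plus, (exp_Ropp (ln_Gamma z)).
        unfold ln_Gamma. rewrite exp_ln by exact HGz. reflexivity. }
      assert (Hyt : Gamma_integrand y t = c * exp (r * A + (1 - r) * B)).
      { unfold c. rewrite <- exp_plus. unfold Gamma_integrand, Rpower.
        rewrite <- exp_plus. f_equal. unfold A, B, y. ring. }
      pose proof (exp_convex A B r Hr) as Hconv.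
      apply (Rmult_le_compat_l c) in Hconv; [|apply Rlt_le, exp_pos].
      rewrite Hyt. eapply Rle_trans; [exact Hconv|]. right.
      rewrite HA, HB. field. lra.
    - now apply Gamma_correct.
    - apply (is_RInt_gen_plus (V := R_NormedModule));
        apply (is_RInt_gen_scal (V := R_NormedModule)); now apply Gamma_correct. }
  unfold norm, plus, scal in H. simpl in H. unfold mult, abs in H. simpl in H.
  rewrite Rabs_pos_eq in H by (apply Rlt_le, Gamma_pos, Hy).
  replace (c * r / Gamma x * Gamma x + c * (1 - r) / Gamma z * Gamma z) with c in H
    by (field; lra).
  apply (ln_le _ _ (Gamma_pos y Hy)) in H.
  unfold c in H. rewrite ln_exp in H. exact H.
Qed.

Lemma ln_Gamma_succ (x : R) : 0 < x -> ln_Gamma (x + 1) = ln_Gamma x + ln x.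
Proof.
  intros Hx. unfold ln_Gamma. rewrite Gamma_succ by exact Hx.
  rewrite ln_mult; [ring|exact Hx|now apply Gamma_pos].
Qed.

(** By [ln_Gamma_succ] the chords over [[y - 1, y]] and [[y, y + 1]] have slopes [ln (y - 1)] and
    [ln y]. Convexity places the slope over [[y, y + h]] between them: [y] has weight [h / (1 + h)]
    on [y - 1] against [y + h], and [y + h] has weight [h] on [y + 1] against [y]. *)
Lemma ln_Gamma_increment (y h : R) : 1 < y -> 0 <= h <= 1 ->
  h * ln (y - 1) <= ln_Gamma (y + h) - ln_Gamma y <= h * ln y.
Proof.
  intros Hy Hh. split.
  - pose proof (ln_Gamma_convex (y - 1) (y + h) (h / (1 + h))) as H.
    assert (Hr : 0 <= h / (1 + h) <= 1).
    { split; [apply Rmult_le_pos; [lra|apply Rlt_le, Rinv_0_lt_compat; lra]|].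
      apply Rmult_le_reg_r with (1 + h); [lra|].
      unfold Rdiv. rewrite Rmult_assoc, Rinv_l; lra. }
    specialize (H ltac:(lra) ltac:(lra) Hr).
    replace (h / (1 + h) * (y - 1) + (1 - h / (1 + h)) * (y + h)) with y in H
      by (field; lra).
    apply (Rmult_le_compat_l (1 + h)) in H; [|lra].
    replace ((1 + h) * (h / (1 + h) * ln_Gamma (y - 1)
              + (1 - h / (1 + h)) * ln_Gamma (y + h)))
      with (h * ln_Gamma (y - 1) + ln_Gamma (y + h)) in H by (field; lra).
    pose proof (ln_Gamma_succ (y - 1) ltac:(lra)) as Hs.
    replace (y - 1 + 1) with y in Hs by ring. nra.
  - pose proof (ln_Gamma_convex (y + 1) y h ltac:(lra) ltac:(lra) Hh) as H.
    replace (h * (y + 1) + (1 - h) * y) with (y + h) in H by ring.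
    rewrite ln_Gamma_succ in H by lra. lra.
Qed.

(** For negative [h] the one-sided bound is applied at [y + h], where the lower slope is
    [ln (y + h - 1)]; this is where [y - 2] comes from. *)
Lemma ln_Gamma_increment_abs (y h : R) : 2 < y -> Rabs h <= 1 ->
  Rabs (ln_Gamma (y + h) - ln_Gamma y - h * ln y) <= Rabs h * (ln y - ln (y - 2)).
Proof.
  intros Hy Hh. destruct (Rle_lt_dec 0 h) as [Hp|Hn].
  - rewrite (Rabs_pos_eq h) in * by exact Hp.
    pose proof (ln_Gamma_increment y h ltac:(lra) ltac:(lra)).
    pose proof (ln_le (y - 2) (y - 1) ltac:(lra) ltac:(lra)).
    rewrite Rabs_left1; nra.
  - rewrite (Rabs_left h) in * by exact Hn.
    pose proof (ln_Gamma_increment (y + h) (- h) ltac:(lra) ltac:(lra)) as H.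
    replace (y + h + - h) with y in H by ring.
    pose proof (ln_le (y - 2) (y + h - 1) ltac:(lra) ltac:(lra)).
    pose proof (ln_le (y + h) y ltac:(lra) ltac:(lra)).
    rewrite Rabs_pos_eq; nra.
Qed.

(** * Polygamma values as Hurwitz series *)

(** Three errors are made small: [e n], [d n - l], and the difference quotient of [G n] against
    [d n]. As [n] is fixed before the increment shrinks, the neighbourhood may depend on [n]. *)
Lemma is_derive_approx (F : R -> R) (G : nat -> R -> R) (d e : nat -> R) (x l : R) :
  (forall n, is_derive (G n) x (d n)) ->
  is_lim_seq d l -> is_lim_seq e 0 ->
  eventually (fun n => locally x (fun y =>
    Rabs (F y - F x - (G n y - G n x)) <= e n * Rabs (y - x))) ->
  is_derive F x l.
Proof.
  intros HG Hd He HF. apply is_derive_Reals. intros eps Heps.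
  assert (He3 : 0 < eps / 3) by lra.
  apply is_lim_seq_spec in Hd. apply is_lim_seq_spec in He.
  destruct (Hd (mkposreal _ He3)) as [N1 H1].
  destruct (He (mkposreal _ He3)) as [N2 H2].
  destruct HF as [N3 H3].
  set (n := (N1 + N2 + N3)%nat).
  specialize (H1 n ltac:(unfold n; lia)). specialize (H2 n ltac:(unfold n; lia)).
  specialize (H3 n ltac:(unfold n; lia)). simpl in H1, H2.
  destruct H3 as [d3 H3]. specialize (HG n). apply is_derive_Reals in HG.
  destruct (HG _ He3) as [d4 H4].
  assert (Hmin : 0 < Rmin d3 d4) by (apply Rmin_pos; apply cond_pos).
  exists (mkposreal _ Hmin). simpl. intros h Hh0 Hh.
  specialize (H4 h Hh0 ltac:(eapply Rlt_le_trans; [exact Hh|apply Rmin_r])).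
  assert (H5 : Rabs (F (x + h) - F x - (G n (x + h) - G n x)) <= e n * Rabs h).
  { replace h with (x + h - x) at 3 by ring. apply H3.
    unfold ball. simpl. unfold AbsRing_ball, abs, minus, plus, opp. simpl.
    replace (x + h + - x) with h by ring.
    eapply Rlt_le_trans; [exact Hh|apply Rmin_l]. }
  assert (Hh1 : 0 < Rabs h) by now apply Rabs_pos_lt.
  assert (H6 : Rabs ((F (x + h) - F x) / h - (G n (x + h) - G n x) / h) <= e n).
  { replace ((F (x + h) - F x) / h - (G n (x + h) - G n x) / h)
      with ((F (x + h) - F x - (G n (x + h) - G n x)) * / h) by (field; exact Hh0).
    rewrite Rabs_mult, Rabs_inv.
    apply Rmult_le_reg_r with (Rabs h); [exact Hh1|].
    rewrite Rmult_assoc, Rinv_l; lra. }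
  replace (e n - 0) with (e n) in H2 by ring.
  apply Rabs_def2 in H1, H2, H4. apply Rabs_le_between in H6.
  apply Rabs_def1; lra.
Qed.

(* The Hurwitz zeta function at [k + 1], with the term of the divergent series
   at [k = 0] regularised. *)
Definition hurwitz_term (k : nat) (y : R) (j : nat) : R :=
  (/ (INR j + y)) ^ S k - match k with O => / INR (S j) | S _ => 0 end.

Definition hurwitz (k : nat) (y : R) : R := Series (hurwitz_term k y).

Lemma ex_series_inv_sq : ex_series (fun j => (/ INR (S j)) ^ 2).
Proof.
  destruct (ex_finite_lim_seq_incr
    (sum_f_R0 (fun j => (/ INR (S j)) ^ 2)) 2) as [l Hl].
  - intros n. rewrite tech5.
    pose proof (pow2_ge_0 (/ INR (S (S n)))). lra.
  (* Telescoping: each term from the second on is at most [1/j - 1/(j + 1)]. *)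
  - intros n. apply Rle_trans with (2 - / INR (S n)).
    + induction n as [|n IH]; [simpl; lra|]. rewrite tech5.
      assert (H0 : 0 < INR (S n)) by (apply lt_0_INR; lia).
      assert (H : (/ INR (S (S n))) ^ 2 <= / INR (S n) - / INR (S (S n))).
      { rewrite (S_INR (S n)).
        replace (/ INR (S n) - / (INR (S n) + 1))
          with (/ (INR (S n) * (INR (S n) + 1))) by (field; lra).
        rewrite pow_inv. apply Rinv_le_contravar; nra. }
      lra.
    + assert (0 < / INR (S n)) by (apply Rinv_0_lt_compat, lt_0_INR; lia). lra.
  - exists l. apply is_series_Reals. now apply is_lim_seq_Reals.
Qed.

(** At [k = 0] the regularised term is [(1 - y) / ((j + y) (j + 1))], so it too decays
    quadratically. *)
Lemma ex_series_hurwitz (k : nat) (y : R) :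
  0 < y -> ex_series (hurwitz_term k y).
Proof.
  intros Hy. destruct k as [|k].
  - apply (ex_series_le (V := R_CompleteNormedModule) _
      (fun j => (Rabs (1 - y) * (1 + / y)) * (/ INR (S j)) ^ 2)).
    2: apply (ex_series_scal_l _ _ ex_series_inv_sq).
    intros j. change (Rabs (hurwitz_term 0 y j)
      <= Rabs (1 - y) * (1 + / y) * (/ INR (S j)) ^ 2).
    pose proof (INR_plus_pos y j Hy). pose proof (pos_INR j).
    assert (Hj : 0 < INR (S j)) by (apply lt_0_INR; lia).
    replace (hurwitz_term 0 y j)
      with ((1 - y) * (INR (S j) * / (INR j + y)) * (/ INR (S j)) ^ 2).
    2:{ unfold hurwitz_term. rewrite S_INR in *. field. lra. }
    assert (Hc : 0 <= INR (S j) * / (INR j + y)).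
    { apply Rmult_le_pos; [lra|]. apply Rlt_le, Rinv_0_lt_compat. lra. }
    rewrite 2!Rabs_mult, (Rabs_pos_eq _ Hc), (Rabs_pos_eq _ (pow2_ge_0 _)).
    apply Rmult_le_compat_r; [apply pow2_ge_0|].
    apply Rmult_le_compat_l; [apply Rabs_pos|].
    rewrite S_INR. now apply inv_shift_le.
  - apply (ex_series_le (V := R_CompleteNormedModule) _
      (fun j => (1 + / y) ^ (k + 2) * (/ INR (S j)) ^ 2)).
    2: apply (ex_series_scal_l _ _ ex_series_inv_sq).
    intros j. change (Rabs (hurwitz_term (S k) y j)
      <= (1 + / y) ^ (k + 2) * (/ INR (S j)) ^ 2).
    unfold hurwitz_term. rewrite Rminus_0_r, Rabs_pos_eq.
    + now apply inv_pow_le.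
    + apply pow_le, Rlt_le, Rinv_0_lt_compat, INR_plus_pos, Hy.
Qed.

Lemma series_cv (f : nat -> R) : ex_series f -> is_lim_seq (sum_f_R0 f) (Series f).
Proof.
  intros Hf. apply is_lim_seq_Reals, is_series_Reals, Series_correct, Hf.
Qed.

(** The Weierstrass test: the tails of [b] bound those of the derived series uniformly on the ball,
    and uniform convergence of the derivatives allows termwise differentiation. *)
Lemma is_derive_Series (u v : nat -> R -> R) (b : nat -> R) (x : R) (r : posreal) :
  (forall j y, Rabs (y - x) < r -> is_derive (u j) y (v j y)) ->
  (forall j y, Rabs (y - x) < r -> Rabs (v j y) <= b j) ->
  ex_series b ->
  (forall y, Rabs (y - x) < r -> ex_series (fun j => u j y)) ->
  is_derive (fun y => Series (fun j => u j y)) x (Series (fun j => v j x)).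
Proof.
  intros Hu Hv Hb Hex.
  assert (Hvex : forall y, Rabs (y - x) < r -> ex_series (fun j => v j y)).
  { intros y Hy. apply (ex_series_le (V := R_CompleteNormedModule) _ b); [|exact Hb].
    intros j. now apply Hv. }
  apply is_derive_Reals.
  apply (CVU_derivable (fun n y => sum_f_R0 (fun j => u j y) n)
    (fun n y => sum_f_R0 (fun j => v j y) n)
    (fun y => Series (fun j => u j y)) (fun y => Series (fun j => v j y)) x r).
  - intros eps Heps.
    pose proof (series_cv b Hb) as Hlim. apply is_lim_seq_spec in Hlim.
    destruct (Hlim (mkposreal _ Heps)) as [N HN]. exists N. intros n y Hn Hy.
    eapply Rle_lt_trans; [|exact (HN n Hn)]. simpl.
    rewrite <- (Rabs_Ropp (sum_f_R0 b n - Series b)).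
    rewrite (Series_incr_n (fun j => v j y) (S n)) by (try lia; now apply Hvex).
    rewrite (Series_incr_n b (S n)) by (try lia; exact Hb).
    simpl pred.
    match goal with |- Rabs (?s + ?t - ?s) <= Rabs (- (?s' - (?s' + ?t'))) =>
      replace (s + t - s) with t by ring;
      replace (- (s' - (s' + t'))) with t' by ring end.
    assert (Hbn : ex_series (fun k => b (S n + k)%nat)).
    { now apply ex_series_incr_n. }
    eapply Rle_trans; [apply Series_Rabs|eapply Rle_trans; [apply Series_le|apply Rle_abs]].
    + apply (ex_series_le (V := R_CompleteNormedModule) _ (fun k => b (S n + k)%nat));
        [|exact Hbn].
      intros j. change (Rabs (Rabs (v (S n + j)%nat y)) <= b (S n + j)%nat).
      rewrite Rabs_Rabsolu. now apply Hv.
    + intros j. split; [apply Rabs_pos|now apply Hv].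
    + exact Hbn.
  - intros y Hy. apply is_lim_seq_Reals, series_cv, Hex, Hy.
  - intros n y Hy. apply is_derive_Reals. induction n as [|n IH].
    + simpl. now apply Hu.
    + rewrite tech5. apply (is_derive_plus (V := R_NormedModule) _ (u (S n)));
        [exact IH|now apply Hu].
  - unfold Boule. rewrite Rminus_diag, Rabs_R0. apply cond_pos.
Qed.

Lemma is_derive_hurwitz (k : nat) (x : R) : 0 < x ->
  is_derive (hurwitz k) x (- INR (S k) * hurwitz (S k) x).
Proof.
  (* On the ball of radius [x / 2] all arguments exceed [x / 2], whose majorant then serves them
     all. *)
  intros Hx. assert (Hx2 : 0 < x / 2) by lra.
  unfold hurwitz at 2. rewrite <- Series_scal_l.
  apply (is_derive_Series (fun j y => hurwitz_term k y j)
    (fun j y => - INR (S k) * hurwitz_term (S k) y j)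
    (fun j => INR (S k) * ((1 + / (x / 2)) ^ (k + 2) * (/ INR (S j)) ^ 2)) x
    (mkposreal _ Hx2)); simpl pos.
  - intros j y Hy. apply Rabs_def2 in Hy.
    pose proof (INR_plus_pos y j ltac:(lra)).
    unfold hurwitz_term. auto_derive; [lra|].
    change (match k with O => 1 | S _ => INR k + 1 end) with (INR (S k)).
    rewrite Rminus_0_r, <- !tech_pow_Rmult. field. lra.
  - intros j y Hy. apply Rabs_def2 in Hy.
    pose proof (INR_plus_pos y j ltac:(lra)).
    pose proof (INR_plus_pos (x / 2) j Hx2).
    rewrite Rabs_mult, Rabs_Ropp, (Rabs_pos_eq _ (pos_INR _)).
    apply Rmult_le_compat_l; [apply pos_INR|].
    unfold hurwitz_term. rewrite Rminus_0_r, Rabs_pos_eq.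
    2:{ apply pow_le, Rlt_le, Rinv_0_lt_compat. lra. }
    eapply Rle_trans; [|now apply inv_pow_le].
    apply pow_incr. split; [apply Rlt_le, Rinv_0_lt_compat; lra|].
    apply Rinv_le_contravar; lra.
  - apply (ex_series_scal_l _ _ (ex_series_scal_l _ _ ex_series_inv_sq)).
  - intros y Hy. apply Rabs_def2 in Hy. apply ex_series_hurwitz. lra.
Qed.

Lemma sum_hurwitz_term (k : nat) (y : R) (n : nat) :
  sum_f_R0 (hurwitz_term k y) n
  = inv_pow_sum y (S k) n - match k with O => harmonic (S n) | S _ => 0 end.
Proof.
  unfold hurwitz_term. rewrite minus_sum. unfold inv_pow_sum. f_equal.
  destruct k; [apply harmonic_sum|]. rewrite sum_cte. ring.
Qed.

Lemma ln_shift_cv (c : R) : 0 <= c ->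
  is_lim_seq (fun n => ln (c + INR (S n)) - ln (INR (S n))) 0.
Proof.
  intros Hc.
  assert (Hi : is_lim_seq (fun n => c * / INR (S n)) 0).
  { replace 0 with (c * 0) by ring. apply is_lim_seq_mult'; [apply is_lim_seq_const|].
    apply (is_lim_seq_inv _ p_infty); [|discriminate].
    apply -> (is_lim_seq_incr_1 INR). apply is_lim_seq_INR. }
  refine (is_lim_seq_le_le (fun _ => 0) _ _ _ _ (is_lim_seq_const 0) Hi).
  intros n. assert (Hn : 0 < INR (S n)) by (apply lt_0_INR; lia). split.
  - pose proof (ln_le (INR (S n)) (c + INR (S n)) Hn ltac:(lra)). lra.
  - rewrite <- ln_div by lra.
    eapply Rle_trans; [apply ln_le_sub1, Rdiv_lt_0_compat; lra|].
    right. field. lra.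
Qed.

Lemma ln_Gamma_shift (x : R) (n : nat) : 0 < x ->
  ln_Gamma (x + INR (S n)) = ln_Gamma x + sum_f_R0 (fun j => ln (INR j + x)) n.
Proof.
  intros Hx. induction n as [|n IH].
  - simpl. rewrite ln_Gamma_succ, Rplus_0_l by exact Hx. reflexivity.
  - rewrite tech5, <- Rplus_assoc, <- IH, (S_INR (S n)), <- Rplus_assoc.
    rewrite ln_Gamma_succ by (pose proof (pos_INR (S n)); lra).
    now rewrite (Rplus_comm x (INR (S n))).
Qed.

(** By [ln_Gamma_shift], [ln_Gamma y] is [ln_Gamma (y + n + 1)] minus a sum of logarithms. The
    approximant replaces the first term, up to a constant, by its affine model of slope
    [ln (x + n + 1)]; [ln_Gamma_increment_abs] bounds the error. *)
Lemma is_derive_ln_Gamma (x : R) : 0 < x ->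
  is_derive ln_Gamma x (- Euler_gamma - hurwitz 0 x).
Proof.
  intros Hx.
  apply (is_derive_approx ln_Gamma
    (fun n y => (y - x) * ln (x + INR (S n)) - sum_f_R0 (fun j => ln (INR j + y)) n)
    (fun n => ln (x + INR (S n)) - inv_pow_sum x 1 n)
    (fun n => ln (x + INR (S n)) - ln (x + INR (S n) - 2))).
  - intros n. unfold inv_pow_sum.
    apply (is_derive_minus (V := R_NormedModule)
      (fun y => (y - x) * ln (x + INR (S n)))).
    + set (c := ln _). auto_derive; [exact I|ring].
    + induction n as [|n IH]; [simpl|rewrite tech5].
      * auto_derive; [lra|field; lra].
      * apply (is_derive_plus (V := R_NormedModule) _ (fun y => ln (INR (S n) + y)));
          [exact IH|].
        pose proof (INR_plus_pos x (S n) Hx) as Hs. revert Hs.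
        generalize (INR (S n)). intros s Hs. auto_derive; [lra|field; lra].
  (* Adding and subtracting [harmonic (S n)] separates Euler's constant from the regularised
     series. *)
  - apply is_lim_seq_ext with (fun n =>
      (ln (x + INR (S n)) - ln (INR (S n)) - gamma_seq (S n))
      - sum_f_R0 (hurwitz_term 0 x) n).
    { intros n. rewrite sum_hurwitz_term. unfold gamma_seq. ring. }
    replace (- Euler_gamma - hurwitz 0 x) with (0 - Euler_gamma - hurwitz 0 x) by ring.
    apply is_lim_seq_minus'; [apply is_lim_seq_minus'|].
    + apply ln_shift_cv. lra.
    + apply -> (is_lim_seq_incr_1 gamma_seq). apply gamma_seq_cv.
    + apply series_cv, ex_series_hurwitz, Hx.
  (* Two further indices absorb the [- 2], so that both shifts are nonnegative as [ln_shift_cv]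
     requires. *)
  - apply (is_lim_seq_incr_n _ 2).
    apply is_lim_seq_ext with (fun n =>
      (ln (x + 2 + INR (S n)) - ln (INR (S n))) - (ln (x + INR (S n)) - ln (INR (S n)))).
    { intros n. replace (n + 2)%nat with (S (S n)) by lia.
      rewrite (S_INR (S (S n))), (S_INR (S n)).
      replace (x + 2 + INR (S n)) with (x + (INR (S n) + 1 + 1)) by ring.
      replace (x + (INR (S n) + 1 + 1) - 2) with (x + INR (S n)) by ring. ring. }
    replace 0 with (0 - 0) by ring.
    apply is_lim_seq_minus'; apply ln_shift_cv; lra.
  (* From index 1 on [x + INR (S n) > 2]; the radius [Rmin 1 x] keeps the increment below 1 and [y]
     positive. *)
  - exists 1%nat. intros n Hn.
    assert (Hr : 0 < Rmin 1 x) by (apply Rmin_pos; lra).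
    exists (mkposreal _ Hr). intros y Hy.
    unfold ball in Hy. simpl in Hy. unfold AbsRing_ball, abs, minus, plus, opp in Hy.
    simpl in Hy. change (y + - x) with (y - x) in Hy.
    pose proof (Rmin_l 1 x). pose proof (Rmin_r 1 x).
    assert (Hy0 : 0 < y) by (apply Rabs_def2 in Hy; lra).
    assert (HN : 2 <= INR (S n)) by (apply (le_INR 2); lia).
    pose proof (ln_Gamma_increment_abs (x + INR (S n)) (y - x) ltac:(lra) ltac:(lra)) as H1.
    replace (x + INR (S n) + (y - x)) with (y + INR (S n)) in H1 by ring.
    rewrite !ln_Gamma_shift in H1 by assumption.
    rewrite (Rmult_comm (Rabs (y - x))) in H1.
    eapply Rle_trans; [right|exact H1]. f_equal. ring.
Qed.

(** Differentiability of [Gamma] is recovered from that of its logarithm, since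
    [Gamma = exp ln_Gamma] near [x]. *)
Lemma digamma_hurwitz (x : R) : 0 < x -> digamma x = - Euler_gamma - hurwitz 0 x.
Proof.
  intros Hx. unfold digamma. pose proof (Gamma_pos x Hx) as HG.
  assert (HD : is_derive Gamma x ((- Euler_gamma - hurwitz 0 x) * Gamma x)).
  { apply (is_derive_ext_loc (fun y => exp (ln_Gamma y))).
    - refine (filter_imp _ _ _ (open_gt 0 x Hx)). intros y Hy.
      unfold ln_Gamma. apply exp_ln, Gamma_pos, Hy.
    - replace (Gamma x) with (exp (ln_Gamma x)) by (unfold ln_Gamma; now apply exp_ln).
      apply (is_derive_comp (V := R_NormedModule) exp ln_Gamma).
      + apply is_derive_Reals, derivable_pt_lim_exp.
      + now apply is_derive_ln_Gamma. }
  rewrite (is_derive_unique _ _ _ HD). field. lra.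
Qed.

Definition polygamma_hurwitz_coeff (k : nat) : R := (-1) ^ S k * INR (fact k).

Lemma polygamma_hurwitz (k : nat) (x : R) : 0 < x ->
  polygamma k x = polygamma_hurwitz_coeff k * hurwitz k x
                  - match k with O => Euler_gamma | S _ => 0 end.
Proof.
  revert x. induction k as [|k IH]; intros x Hx; unfold polygamma.
  - simpl. rewrite digamma_hurwitz by exact Hx.
    unfold polygamma_hurwitz_coeff. simpl. ring.
  - simpl Derive_n. apply is_derive_unique.
    (* The induction hypothesis covers positive arguments only, which form a neighbourhood of
       [x]. *)
    apply (is_derive_ext_loc (fun y => polygamma_hurwitz_coeff k * hurwitz k y
      - match k with O => Euler_gamma | S _ => 0 end)).
    + refine (filter_imp _ _ _ (open_gt 0 x Hx)). intros y Hy. symmetry. now apply IH.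
    + replace (polygamma_hurwitz_coeff (S k) * hurwitz (S k) x - 0)
        with (minus (polygamma_hurwitz_coeff k * (- INR (S k) * hurwitz (S k) x)) zero).
      2:{ unfold minus, plus, opp, zero, polygamma_hurwitz_coeff. simpl plus.
          rewrite fact_simpl, mult_INR. simpl. ring. }
      apply (is_derive_minus (V := R_NormedModule)).
      * apply (is_derive_scal (hurwitz k)). now apply is_derive_hurwitz.
      * apply (is_derive_const (V := R_NormedModule)).
Qed.

(** * The limit of the convolution identity and its polygamma form *)

Lemma is_lim_seq_sum_f_R0 (u : nat -> nat -> R) (l : nat -> R) (q : nat) :
  (forall k, is_lim_seq (u k) (l k)) ->
  is_lim_seq (fun n => sum_f_R0 (fun k => u k n) q) (sum_f_R0 l q).
Proof.
  intros H. induction q as [|q IH]; [apply H|].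
  simpl. apply is_lim_seq_plus'; [exact IH|apply H].
Qed.

Lemma harmonic_series_hurwitz (a : R) (q : nat) : 0 < a -> (1 <= q)%nat ->
  is_series (fun k => harmonic (S k) / (INR (S k) + a) ^ S q)
    (/ 2 * (INR (S q) * hurwitz (S q) a
            - sum_f_R0 (fun k => hurwitz k a * hurwitz (q - k) a) q)).
Proof.
  intros Ha Hq. set (l := / 2 * _).
  (* A term of index 0 is added; it vanishes because [harmonic 0 = 0]. *)
  apply (is_series_incr_1 (fun k => harmonic k / (INR k + a) ^ S q)).
  rewrite harmonic_0. replace (plus l _) with l
    by (unfold plus; simpl plus; unfold Rdiv; rewrite Rmult_0_l; simpl; ring).
  apply is_series_Reals, is_lim_seq_Reals.
  apply is_lim_seq_ext with (fun n =>
    / 2 * (INR (S q) * sum_f_R0 (hurwitz_term (S q) a) n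
      - sum_f_R0 (fun k => sum_f_R0 (hurwitz_term k a) n
                           * sum_f_R0 (hurwitz_term (q - k) a) n) q)
    - sum_f_R0 (fun j =>
        (harmonic (S n) - harmonic (n - j)) * (/ (INR j + a)) ^ S q) n).
  - intros n.
    (* Regularising the first power sum by [- harmonic (S n)] subtracts [2 * harmonic (S n) *
       inv_pow_sum a (S q) n] from the convolution. This turns [harmonic (n - j)] into
       [harmonic (n - j) - harmonic (S n)], hence the exact identity for partial sums. *)
    pose proof (convolution_shift_0 (fun _ => 1) (fun k => inv_pow_sum a (S k) n)
      (fun k => sum_f_R0 (hurwitz_term k a) n) (- harmonic (S n)) q Hq
      eq_refl eq_refl) as Hsh.
    cbv beta in Hsh. rewrite (sum_hurwitz_term 0) in Hsh. specialize (Hsh eq_refl).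
    assert (Hk : forall k, (1 <= k)%nat ->
      sum_f_R0 (hurwitz_term k a) n = inv_pow_sum a (S k) n).
    { intros k Hk. rewrite sum_hurwitz_term. destruct k; [lia|ring]. }
    specialize (Hsh Hk).
    rewrite (sum_eq (fun k => 1 * sum_f_R0 (hurwitz_term k a) n * _)
      (fun k => sum_f_R0 (hurwitz_term k a) n
                * sum_f_R0 (hurwitz_term (q - k) a) n)) in Hsh by (intros; ring).
    rewrite (sum_eq (fun k => 1 * inv_pow_sum a (S k) n * _)
      (fun k => inv_pow_sum a (S k) n * inv_pow_sum a (S (q - k)) n))
      in Hsh by (intros; ring).
    rewrite Hsh, inv_pow_sum_convolution, Hk by (assumption || lia).
    unfold inv_pow_sum at 3.
    rewrite (sum_eq (fun j => (harmonic (n - j) - harmonic j) * (/ (INR j + a)) ^ S q)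
      (fun j => harmonic (S n) * (/ (INR j + a)) ^ S q
        - (harmonic (S n) - harmonic (n - j)) * (/ (INR j + a)) ^ S q
        - harmonic j / (INR j + a) ^ S q)).
    2:{ intros j Hj. unfold Rdiv. rewrite <- pow_inv. ring. }
    rewrite !minus_sum, sum_f_R0_scal_l. field.
  - replace l with (l - 0) by ring.
    apply is_lim_seq_minus'; [|now apply harmonic_tail_error].
    apply is_lim_seq_mult'; [apply is_lim_seq_const|].
    assert (Hlim : forall k, is_lim_seq (sum_f_R0 (hurwitz_term k a)) (hurwitz k a)).
    { intros k. apply series_cv, ex_series_hurwitz, Ha. }
    apply is_lim_seq_minus'.
    + apply is_lim_seq_mult'; [apply is_lim_seq_const|apply Hlim].
    + apply (is_lim_seq_sum_f_R0 (fun k n => sum_f_R0 (hurwitz_term k a) n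
        * sum_f_R0 (hurwitz_term (q - k) a) n) (fun k => hurwitz k a * hurwitz (q - k) a)).
      intros k. apply is_lim_seq_mult'; apply Hlim.
Qed.

(** The term in [2 * Euler_gamma] removes the constant carried by [polygamma 0]. The binomial weight
    then cancels [k!] and [(q - k)!], leaving [q!] and the sign [(-1)^(q + 2)]. *)
Lemma polygamma_convolution (a : R) (q : nat) : 0 < a -> (1 <= q)%nat ->
  polygamma (S q) a - 2 * Euler_gamma * polygamma q a
  - sum_f_R0 (fun k => Binomial.C q k * polygamma k a * polygamma (q - k) a) q
  = (-1) ^ q * INR (fact q) *
    (INR (S q) * hurwitz (S q) a
     - sum_f_R0 (fun k => hurwitz k a * hurwitz (q - k) a) q).
Proof.
  intros Ha Hq.
  pose proof (convolution_shift_0 (Binomial.C q) (fun k => polygamma k a)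
    (fun k => polygamma_hurwitz_coeff k * hurwitz k a) Euler_gamma q Hq
    (C_n_0 q) (C_n_n q)) as Hsh.
  cbv beta in Hsh. rewrite (polygamma_hurwitz 0) in Hsh by exact Ha.
  specialize (Hsh ltac:(ring)).
  assert (Hk : forall k, (1 <= k)%nat ->
    polygamma_hurwitz_coeff k * hurwitz k a = polygamma k a).
  { intros k Hk. rewrite polygamma_hurwitz by exact Ha. destruct k; [lia|ring]. }
  specialize (Hsh Hk).
  rewrite (sum_eq (fun k => Binomial.C q k * (polygamma_hurwitz_coeff k * hurwitz k a) * _)
    (fun k => (-1) ^ q * INR (fact q) * (hurwitz k a * hurwitz (q - k) a))) in Hsh.
  2:{ intros k Hkq. unfold polygamma_hurwitz_coeff, Binomial.C.
      replace ((-1) ^ q) with ((-1) ^ S k * (-1) ^ S (q - k)).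
      - field. split; apply INR_fact_neq_0.
      - rewrite <- pow_add. replace (S k + S (q - k))%nat with (2 + q)%nat by lia.
        simpl. ring. }
  rewrite sum_f_R0_scal_l in Hsh.
  assert (HS : polygamma (S q) a
    = (-1) ^ q * INR (fact q) * (INR (S q) * hurwitz (S q) a)).
  { rewrite <- Hk by lia. unfold polygamma_hurwitz_coeff.
    rewrite fact_simpl, mult_INR. simpl. ring. }
  rewrite HS. lra.
Qed.

Theorem corollary1 (m n p : nat) (hm : (1 <= m)%nat) (hn : (1 <= n)%nat)
    (hmn : Nat.gcd m n = 1%nat) (hp : (2 <= p)%nat) :
  is_series
    (fun k : nat => harmonic (S k) / (INR m * INR (S k) + INR n) ^ p)
    ((- 1) ^ (p - 1) / (2 * INR m ^ p * INR (fact (p - 1))) *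
     (polygamma p (INR n / INR m)
      - 2 * Euler_gamma * polygamma (p - 1) (INR n / INR m)
      - sum_f_R0
          (fun k : nat => Binomial.C (p - 1) k * polygamma k (INR n / INR m)
                          * polygamma (p - 1 - k) (INR n / INR m))
          (p - 1))).
Proof.
  destruct p as [|q]; [lia|]. rewrite Nat.sub_succ, Nat.sub_0_r.
  assert (Hm : 0 < INR m) by (apply lt_0_INR; lia).
  assert (Hn : 0 < INR n) by (apply lt_0_INR; lia).
  assert (Ha : 0 < INR n / INR m) by now apply Rdiv_lt_0_compat.
  set (a := INR n / INR m) in *.
  rewrite polygamma_convolution by (assumption || lia).
  pose proof (harmonic_series_hurwitz a q Ha ltac:(lia)) as H.
  (* The factor comes from [m k + n = m (k + a)]. *)
  apply (is_series_scal_l (/ INR m ^ S q)) in H.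
  eapply is_series_ext; [|evar_last; [exact H|]].
  - intros k. cbv beta.
    match goal with |- scal ?c ?x = ?r => change (@eq R (c * x) r) end.
    replace (INR m * INR (S k) + INR n) with (INR m * (INR (S k) + a))
      by (unfold a; field; lra).
    rewrite Rpow_mult_distr. unfold Rdiv. rewrite Rinv_mult. ring.
  - match goal with |- scal ?c ?x = ?r => change (@eq R (c * x) r) end.
    (* The sign in the claimed value meets the one from [polygamma_convolution]. *)
    assert (Hsq : (-1) ^ q * (-1) ^ q = 1).
    { rewrite <- Rpow_mult_distr. replace (-1 * -1) with 1 by ring. apply pow1. }
    match goal with |- _ * (_ * ?s) = _ => set (e := s) end.
    assert (Hmq : INR m ^ S q <> 0) by (apply pow_nonzero; lra).
    pose proof (INR_fact_neq_0 q) as Hfq.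
    transitivity (((-1) ^ q * (-1) ^ q) * (/ INR m ^ S q * (/ 2 * e))).
    + rewrite Hsq. ring.
    + field. split; assumption.
Qed.
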